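(* There is an absolute constant $C>0$ such that the following holds. Let $G$ be a strongly regular graph with parameters $(n,k,\lambda,\mu)$, $k\le (n-1)/2$, and adjacency eigenvalues $k\ge r>s$, satisfying the claw bound \[ r \le \max\left\{2(-s-1)(\mu+1+s)+s,\ \frac{s(s+1)(\mu+1)}{2}-1\right\}. \] Then $\lambda/n \le C\, h(n,k)$, where \[ h(n,k) = \min\left\{\left(\frac{k}{n}\right)^{4/3},\ \max\left\{\frac{k^{1/2}}{n^{3/4}},\ \left(\frac{k}{n}\right)^2\right\},\ \max\left\{\left(\frac{k}{n}\right)^{3/2},\ \left(\frac{1}{n}\right)^{1/2}\right\}\right\}. \]
   Context: A strongly regular graph with parameters $(n,k,\lambda,\mu)$ is a $k$-regular graph on $n$ vertices in which any two adjacent vertices have exactly $\lambda$ common neighbors and any two distinct nonadjacent vertices have exactly $\mu$ common neighbors. Its adjacency eigenvalues are $k$ and two other (restricted) eigenvalues $r>s$, with $k\ge r$. *)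

(* Defs.v *)
From HB Require Import structures.
From mathcomp Require Import all_boot all_order all_algebra.
From mathcomp Require Import reals exp Rstruct.
From Stdlib Require Import Rdefinitions.

Set Implicit Arguments.
Unset Strict Implicit.
Unset Printing Implicit Defensive.

Import Order.TTheory GRing.Theory Num.Theory.
Local Open Scope ring_scope.

Definition simple_graph (n : nat) (e : rel 'I_n) : Prop :=
  (forall x y, e x y = e y x) /\ (forall x, ~~ e x x).

Definition srg (n k lam mu : nat) (e : rel 'I_n) : Prop :=
  [/\ simple_graph e,
      (forall x, #|[set y | e x y]| = k),
      (forall x y, e x y -> #|[set z | e x z & e y z]| = lam) &
      (forall x y, x != y -> ~~ e x y -> #|[set z | e x z & e y z]| = mu)].

Definition adj_mx (n : nat) (e : rel 'I_n) : 'M[R]_n :=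
  \matrix_(i, j) (e i j)%:R.

Definition restricted_eigenvalue (n : nat) (e : rel 'I_n) (theta : R) : Prop :=
  exists v : 'cV[R]_n,
    [/\ v != 0, \sum_i v i ord0 = 0 & adj_mx e *m v = theta *: v].

Definition h_fun (n k : nat) : R :=
  let kn : R := k%:R / n%:R in
  Num.min (powR kn (4 / 3))
    (Num.min (Num.max (powR k%:R (1 / 2) / powR n%:R (3 / 4)) (powR kn 2))
             (Num.max (powR kn (3 / 2)) (powR (1 / n%:R) (1 / 2)))).

(* Main.v *)
Require Import Defs.
From HB Require Import structures.
From mathcomp Require Import all_boot all_order all_algebra.
From mathcomp Require Import reals exp Rstruct.
From mathcomp Require Import zify ring lra.
From Stdlib Require Import Rdefinitions.
Import Order.TTheory GRing.Theory Num.Theory.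

(** The claw bound forces mu >= 1, hence mu <= 3 k^2 / n, and
    lam = mu + r + s <= mu + r, so for the first two bounds it suffices to
    control r.

    - (k/n)^(4/3): the claw bound gives r <= s^2 (mu + 1), and r (-s) <= k, so
      r^3 <= k^2 (mu + 1).
    - k^(1/2) / n^(3/4): if f is the multiplicity of r, the trace of A gives
      f r^2 <= n k, while the absolute bound n <= (f + 1)^2 holds because the
      Hadamard product (A - s) o (A - s - J) is a nonzero scalar matrix.
    - (k/n)^(3/2) or n^(-1/2): let lam^2 >= 20 k mu.  For a maximum independent
      set I_x of the neighbourhood of x, the vertices of this neighbourhood
      having exactly one member of I_x in their closed neighbourhood form
      |I_x| <= 2 k / lam cliques of size about lam, and few vertices are left
      over.  For nonadjacent x, z a clique at x meets a clique at z in at most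
      one vertex, so that, up to the few left-over vertices,
      mu <= |I_x| |I_z| <= 4 k^2 / lam^2; as mu is about k^2 / n, this bounds
      lam^2 by a multiple of n. *)

(** * Cliques in the neighbourhood of a vertex *)

Section LocalStructure.
Local Open Scope nat_scope.

Variables (n k lam mu : nat) (e : rel 'I_n).
Hypothesis srge : srg k lam mu e.

Definition nbh (x : 'I_n) : {set 'I_n} := [set y | e x y].
(** Reflexive, so that a member of [I] is one of its own owners. *)
Definition cadj (y p : 'I_n) : bool := (y == p) || e y p.
Definition indep (I : {set 'I_n}) : bool :=
  [forall y in I, forall z in I, ~~ e y z].
Definition owners (I : {set 'I_n}) (p : 'I_n) : {set 'I_n} :=
  [set y in I | cadj y p].

Lemma srg_sym x y : e x y = e y x.
Proof. by have [[H _] _ _ _] := srge; apply: H. Qed.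

Lemma srg_irr x : e x x = false.
Proof. by have [[_ H] _ _ _] := srge; apply/negbTE. Qed.

Lemma card_nbh x : #|nbh x| = k.
Proof. by have [_ H _ _] := srge; apply: H. Qed.

Lemma indepP (I : {set 'I_n}) :
  reflect {in I &, forall y z, ~~ e y z} (indep I).
Proof.
apply: (iffP forall_inP) => [H y z yI zI|H y yI].
  by have /forall_inP := H y yI; apply.
by apply/forall_inP => z zI; apply: H.
Qed.

Lemma indepS (I J : {set 'I_n}) : I \subset J -> indep J -> indep I.
Proof.
move=> /subsetP IJ /indepP iJ; apply/indepP => y z yI zI.
by apply: iJ; apply: IJ.
Qed.

Lemma card_closed_nbh x y : y \in nbh x ->
  #|[set p in nbh x | cadj y p]| = lam.+1.
Proof.
rewrite inE => exy.
have -> : [set p in nbh x | cadj y p] = y |: [set z | e x z & e y z].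
  apply/setP => p; rewrite !inE /cadj eq_sym.
  by have [->|] := eqVneq p y; rewrite ?exy.
have [_ _ H _] := srge.
by rewrite cardsU1 !inE srg_irr andbF H.
Qed.

(** Neither [y] nor [z] lies in both closed neighbourhoods, so these meet only in common
    neighbours. *)
Lemma card_closed_nbh2 x y z : y != z -> ~~ e y z ->
  #|[set p in nbh x | cadj y p && cadj z p]| <= mu.
Proof.
move=> yz eyz; have [_ _ _ H] := srge; rewrite -(H _ _ yz eyz).
apply/subset_leq_card/subsetP => p; rewrite !inE /cadj => /andP[_].
have [<-|_] := eqVneq y p; first by rewrite eq_sym (negbTE yz) srg_sym (negbTE eyz).
have [<-|//] := eqVneq z p.
by rewrite (negbTE eyz).
Qed.

(** * Double counting of owners *)

Lemma card_owners (I : {set 'I_n}) p : #|owners I p| = \sum_(y in I) cadj y p.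
Proof.
rewrite -sum1_card big_mkcond [RHS]big_mkcond; apply: eq_bigr => y _.
by rewrite inE; case: (y \in I) => //=; case: (cadj y p).
Qed.

Lemma exchange_cadj (A I : {set 'I_n}) (F : 'I_n -> nat) :
  \sum_(p in A) #|owners I p| * F p =
  \sum_(y in I) \sum_(p in A | cadj y p) F p.
Proof.
under eq_bigr => p _ do rewrite card_owners big_distrl /=.
rewrite exchange_big; apply: eq_bigr => y _ /=.
rewrite [RHS]big_mkcondr; apply: eq_bigr => p _.
by case: cadj; rewrite ?mul1n ?mul0n.
Qed.

Lemma sum_owners x (I : {set 'I_n}) : I \subset nbh x ->
  \sum_(p in nbh x) #|owners I p| = #|I| * lam.+1.
Proof.
move=> /subsetP sI.
rewrite (eq_bigr (fun p => #|owners I p| * 1)); last by move=> p _; rewrite muln1.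
rewrite exchange_cadj -sum_nat_const; apply: eq_bigr => y yI.
rewrite -(card_closed_nbh _ _ (sI y yI)) -sum1_card.
by apply: eq_bigl => p; rewrite !inE.
Qed.

Lemma card_ownersD1 (I : {set 'I_n}) y p : y \in I -> cadj y p ->
  #|owners I p|.-1 = #|owners (I :\ y) p|.
Proof.
move=> yI yp; have yO : y \in owners I p by rewrite inE yI.
rewrite (cardsD1 y) yO /=; apply: eq_card => z.
by rewrite !inE andbA.
Qed.

(** Counts pairs of a vertex [p] owned by [y] and a second owner of [p]; each other member of [I]
    occurs in at most [mu] of them. *)
Lemma sum_co_owners x (I : {set 'I_n}) y : indep I -> y \in I ->
  \sum_(p in nbh x | cadj y p) #|owners I p|.-1 <= #|I|.-1 * mu.
Proof.
move=> /indepP iI yI.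
rewrite (eq_bigr (fun p => #|owners (I :\ y) p| * 1)); last first.
  by move=> p /andP[_ yp]; rewrite muln1 (card_ownersD1 I y p).
rewrite (eq_bigl (mem [set p in nbh x | cadj y p])); last first.
  by move=> p; rewrite /= !inE.
rewrite exchange_cadj.
have -> : #|I|.-1 = #|I :\ y| by rewrite (cardsD1 y I) yI.
rewrite -sum_nat_const; apply: leq_sum => z; rewrite !inE => /andP[zy zI].
apply: leq_trans (card_closed_nbh2 x y z _ (iI _ _ yI zI)); last by rewrite eq_sym.
rewrite -sum1_card; apply: eq_leq; apply: eq_bigl => p.
by rewrite !inE andbA.
Qed.

Lemma sum_owner_pairs x (I : {set 'I_n}) : indep I ->
  \sum_(p in nbh x) #|owners I p| * #|owners I p|.-1 <= #|I| * (#|I|.-1 * mu).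
Proof.
move=> iI; rewrite exchange_cadj -sum_nat_const.
by apply: leq_sum => y yI; apply: sum_co_owners.
Qed.

(* Bonferroni for the closed neighbourhoods of the members of [I] inside [nbh x]. *)
Lemma claw_inequality x (I : {set 'I_n}) : I \subset nbh x -> indep I ->
  2 * (#|I| * lam.+1) <= 2 * k + #|I| * (#|I|.-1 * mu).
Proof.
move=> sI iI; rewrite -(sum_owners _ _ sI).
apply: leq_trans (leq_add (leqnn _) (sum_owner_pairs x I iI)).
rewrite -(card_nbh x) -sum1_card !big_distrr -big_split /=.
(* Pointwise, a vertex with d owners satisfies 2 d <= 2 + d (d - 1). *)
by apply: leq_sum => p _; case: #|owners I p| => [|[|d]]; nia.
Qed.

(** [shared] holds the left-over vertices; each [cell] becomes a clique once [I] is maximum. *)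
Definition shared x (I : {set 'I_n}) := [set p in nbh x | 1 < #|owners I p|].
Definition cell x (I : {set 'I_n}) y := [set p in nbh x | owners I p == [set y]].

Lemma card_shared x (I : {set 'I_n}) : indep I ->
  2 * #|shared x I| <= #|I| * (#|I|.-1 * mu).
Proof.
move=> iI; apply: leq_trans (sum_owner_pairs x I iI).
rewrite -sum1_card big_distrr /= big_mkcond [X in _ <= X]big_mkcond /=.
apply: leq_sum => p _; rewrite !inE; case: (e x p) => //=.
by case: #|owners I p| => [|[|d]] //=; nia.
Qed.

(** A vertex owned by [y] but outside its cell has a second owner, hence contributes to
    [sum_co_owners]. *)
Lemma card_cell x (I : {set 'I_n}) y : I \subset nbh x -> indep I -> y \in I ->
  lam.+1 <= #|cell x I y| + #|I|.-1 * mu.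
Proof.
move=> /subsetP sI iI yI; rewrite -(card_closed_nbh _ _ (sI y yI)).
apply: leq_trans (leq_add (leqnn _) (sum_co_owners x I y iI yI)).
rewrite -!sum1_card big_mkcond [X in _ <= X + _]big_mkcond /=.
rewrite [X in _ <= _ + X]big_mkcond -big_split /=.
apply: leq_sum => p _; rewrite !inE; case: (e x p) => //=.
have [yp|//] := boolP (cadj y p).
have yO : y \in owners I p by rewrite inE yI.
have [//|oI] := eqVneq (owners I p) [set y].
case E: #|owners I p| => [|[|d]] //=.
  by move/eqP: E; rewrite cards_eq0 => /eqP E; rewrite E inE in yO.
move/eqP/cards1P: E => [z E]; case/eqP: oI; rewrite E in yO *.
by rewrite inE in yO; rewrite (eqP yO).
Qed.

(** * Maximum independent sets and their cells *)

Definition max_indep x (I : {set 'I_n}) : Prop :=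
  [/\ I \subset nbh x, indep I &
   forall J : {set 'I_n}, J \subset nbh x -> indep J -> #|J| <= #|I|].

Lemma ex_max_indep x : exists I, max_indep x I.
Proof.
pose P (I : {set 'I_n}) := (I \subset nbh x) && indep I.
have P0 : P set0 by rewrite /P sub0set; apply/indepP => y z; rewrite inE.
case: (arg_maxnP (fun I : {set 'I_n} => #|I|) P0) => I /andP[sI iI] mI.
by exists I; split=> // J sJ iJ; apply: mI; rewrite /P sJ.
Qed.

(** A vertex without owner could be added to [I]. *)
Lemma max_indep_owned x (I : {set 'I_n}) p : max_indep x I -> p \in nbh x ->
  0 < #|owners I p|.
Proof.
move=> [sI iI mI] px; rewrite lt0n cards_eq0; apply/negP => /eqP O0.
have Op y : y \in I -> (y != p) && ~~ e y p.
  move=> yI; rewrite -negb_or; apply/negP => yp.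
  by have := in_set0 y; rewrite -O0 inE yI /cadj yp.
have pI : p \notin I by apply/negP => /Op; rewrite eqxx.
suff : #|p |: I| <= #|I| by rewrite cardsU1 pI ltnn.
apply: mI; first by rewrite subUset sub1set px.
move/indepP: iI => iI; apply/indepP => y z; rewrite !inE.
move=> /orP[/eqP->|yI] /orP[/eqP->|zI]; first by rewrite srg_irr.
- by rewrite srg_sym; case/andP: (Op z zI).
- by case/andP: (Op y yI).
- exact: iI.
Qed.

(* Two nonadjacent vertices of a cell could replace its owner in [I]. *)
Lemma cell_clique x (I : {set 'I_n}) y p q : max_indep x I -> y \in I ->
  p \in cell x I y -> q \in cell x I y -> p != q -> e p q.
Proof.
move=> [sI iI mI] yI; rewrite !inE => /andP[xp /eqP Op] /andP[xq /eqP Oq] pq.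
apply/negPn/negP => epq.
have own u z : owners I u = [set y] -> z \in I :\ y -> (z != u) && ~~ e z u.
  move=> Ou; rewrite !inE => /andP[zy zI]; rewrite -negb_or; apply/negP => zu.
  have : z \in owners I u by rewrite inE zI.
  by rewrite Ou inE (negbTE zy).
have pI : p \notin I :\ y by apply/negP => /(own _ _ Op); rewrite eqxx.
have qI : q \notin I :\ y by apply/negP => /(own _ _ Oq); rewrite eqxx.
have : #|p |: (q |: I :\ y)| <= #|I|.
  apply: mI.
    rewrite !subUset !sub1set !inE xp xq /=.
    by apply: subset_trans sI; apply: subD1set.
  move/indepP: iI => iI; apply/indepP => u v; rewrite 2!in_setU1.
  rewrite [v \in _]in_setU1 [v \in _ |: _]in_setU1.
  move=> /or3P[/eqP->|/eqP->|uI] /or3P[/eqP->|/eqP->|vI]; rewrite ?srg_irr //.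
  + by rewrite srg_sym; case/andP: (own _ _ Op vI).
  + by rewrite srg_sym.
  + by rewrite srg_sym; case/andP: (own _ _ Oq vI).
  + by case/andP: (own _ _ Op uI).
  + by case/andP: (own _ _ Oq uI).
  + by apply: iI; [case/setD1P: uI | case/setD1P: vI].
rewrite !cardsU1 qI in_setU1 (negbTE pq) pI (cardsD1 y I) yI /=.
by rewrite !add1n ltnn.
Qed.


Lemma sum_card_nbhI (A : {set 'I_n}) : \sum_z #|A :&: nbh z| = #|A| * k.
Proof.
rewrite -sum_nat_const.
under eq_bigr => z _.
  rewrite -sum1_card (eq_bigl (fun p => (p \in A) && e z p)); last first.
    by move=> p; rewrite !inE.
  over.
rewrite (exchange_big_dep (mem A)) /=; last by move=> z p _ /andP[].
apply: eq_bigr => p pA; rewrite pA /= -(card_nbh p) -sum1_card.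
by apply: eq_bigl => z; rewrite inE srg_sym.
Qed.

Lemma card_nonnbh x : #|[set z | (z != x) && ~~ e x z]| = n - k.+1.
Proof.
have -> : [set z | (z != x) && ~~ e x z] = ~: (x |: nbh x).
  by apply/setP => z; rewrite !inE negb_or.
by rewrite cardsCs setCK cardsU1 inE srg_irr card_nbh card_ord.
Qed.

Lemma ex_subset_card (A : {set 'I_n}) t : t <= #|A| ->
  exists2 B : {set 'I_n}, B \subset A & #|B| = t.
Proof.
case/card_geqP => s [us <- /subsetP sA]; exists [set y in s].
  by apply/subsetP => y; rewrite inE => /(subsetP sA).
by rewrite cardsE; apply/card_uniqP.
Qed.

(** * The range lam^2 >= 20 k mu *)

Hypotheses (k_gt0 : 0 < k) (mu_gt0 : 0 < mu).
Hypothesis lam_large : 20 * (k * mu) <= lam * lam.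

Lemma lam_gt0 : 0 < lam.
Proof.
rewrite lt0n; apply/negP => /eqP l0; move: lam_large.
by rewrite l0 leqn0 !muln_eq0 !gtn_eqF.
Qed.

(** The product of the hypotheses bounds a b lam^2 by c d k^2; [lam_large] trades the factor 20 k mu
    for lam^2, which cancels. *)
Lemma pair_bound a b c d : a * lam <= c * k -> b * lam <= d * k ->
  20 * (a * (b * mu)) <= c * d * k.
Proof.
move=> ac bd; have lam2 : 0 < (lam * lam) by rewrite muln_gt0 lam_gt0.
rewrite -(leq_pmul2r lam2).
have H1 := leq_mul ac bd.
have H2 : 20 * (a * (b * mu)) * (lam * lam) = (a * lam * (b * lam)) * (20 * mu).
  by ring.
rewrite H2; apply: leq_trans (leq_mul H1 (leqnn _)) _.
have -> : c * k * (d * k) * (20 * mu) = (c * d * k) * (20 * (k * mu)) by ring.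
by rewrite leq_mul2l lam_large orbT.
Qed.

Hypothesis lam_lt : lam.+1 < k.

(** Otherwise a subset [J] of the least size with |J| lam >= 2 k violates [claw_inequality]: the
    left side exceeds 4 k, while the pair term on the right is at most 6 k / 20. *)
Lemma card_indep x (I : {set 'I_n}) : I \subset nbh x -> indep I ->
  #|I| * lam <= 2 * k.
Proof.
move=> sI iI; rewrite leqNgt; apply/negP => big.
have ex : exists t, 2 * k <= t * lam by exists #|I|; apply: ltnW.
case: (ex_minnP ex) => -[|t]; first by lia.
move=> tge tmin.
have tI : t.+1 <= #|I| by apply: tmin; apply: ltnW.
have tlt : t * lam <= 2 * k.
  by rewrite leqNgt; apply/negP => /ltnW /tmin; rewrite ltnn.
have [J sJ cJ] := ex_subset_card I t.+1 tI.
have := claw_inequality x J (subset_trans sJ sI) (indepS _ _ sJ iI).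
rewrite cJ /=.
(* The 3 comes from t lam <= 2 k by minimality, and lam < k. *)
have := pair_bound t.+1 t 3 2 _ tlt.
have -> : t.+1 * lam <= 3 * k by lia.
move=> /(_ isT); move: tge; rewrite mulnS; set X := _ * (_ * mu); lia.
Qed.

Lemma card_indep_pairs x (I : {set 'I_n}) : I \subset nbh x -> indep I ->
  20 * (#|I| * (#|I|.-1 * mu)) <= 4 * k.
Proof.
move=> sI iI; have H := card_indep x I sI iI.
apply: (pair_bound _ _ 2 2) => //; apply: leq_trans H.
by rewrite leq_mul2r leq_pred orbT.
Qed.

(** A maximum [I] has at least two members, since one closed neighbourhood is too small to cover
    [nbh x]; [claw_inequality] then gives 2 (lam + 1) <= |I| (lam + 1) <= 1.1 k. *)
Lemma lam_small (x : 'I_n) : 80 * lam.+1 <= 44 * k.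
Proof.
have [I mI] := ex_max_indep x; have [sI iI _] := mI.
have cover : k <= #|I| * lam.+1.
  rewrite -(sum_owners x I sI) -(card_nbh x) -sum1_card.
  by apply: leq_sum => p px; apply: max_indep_owned mI px.
have t2 : 2 <= #|I|.
  by case: #|I| cover => [|[|//]]; lia.
have := claw_inequality x I sI iI.
have := card_indep_pairs x I sI iI.
have := leq_mul t2 (leqnn lam.+1).
set X := _ * (_ * mu); lia.
Qed.

(* Two common vertices [p], [q] of these cliques would have almost [2 * lam]
   common neighbours. *)
Lemma cells_meet x z (I J : {set 'I_n}) y w :
  x != z -> ~~ e x z -> max_indep x I -> max_indep z J ->
  y \in I -> w \in J -> #|cell x I y :&: cell z J w| <= 1.
Proof.
move=> xz exz mI mJ yI wJ; rewrite leqNgt; apply/negP => /card_gt1P.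
move=> [p [q [/setIP[pI pJ] /setIP[qI qJ] pq]]].
set Q := cell x I y in pI qI *; set Q' := cell z J w in pJ qJ *.
have epq := cell_clique _ _ _ _ _ mI yI pI qI pq.
have [sI iI _] := mI; have [sJ iJ _] := mJ.
have cQ := card_cell x I y sI iI yI.
have cQ' := card_cell z J w sJ iJ wJ.
have [_ _ Hlam Hmu] := srge.
have cI : #|Q :&: Q'| <= mu.
  rewrite -(Hmu _ _ xz exz); apply/subset_leq_card/subsetP => u.
  by rewrite !inE => /andP[/andP[-> _] /andP[-> _]].
have cU : #|Q :|: Q'| <= lam.+2.
  have -> : lam.+2 = (#|[set u | e p u & e q u]| + #|[set p; q]|).
    by rewrite Hlam // cards2 pq addn2.
  apply: leq_trans (leq_card_setU _ _).
  apply/subset_leq_card/subsetP => u uU.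
  rewrite !inE; have [_|up] := eqVneq u p; first by rewrite orbT.
  have [_|uq] := eqVneq u q; first by rewrite !orbT.
  rewrite !orbF; case/setUP: uU => uQ.
    by rewrite !(cell_clique _ _ _ _ _ mI yI) // eq_sym.
  by rewrite !(cell_clique _ _ _ _ _ mJ wJ) // eq_sym.
have tI := card_indep x I sI iI; have tJ := card_indep z J sJ iJ.
have UI := cardsUI Q Q'.
have I0 : 0 < #|I| by apply/card_gt0P; exists y.
have J0 : 0 < #|J| by apply/card_gt0P; exists w.
(* Inclusion-exclusion: each cell misses at most (|I| - 1) mu or (|J| - 1) mu of lam + 1 vertices,
   the union has at most lam + 2 and the intersection at most mu. Multiplied by lam, this gives
   lam^2 <= 4 k mu, against [lam_large]. *)
have : lam <= (#|I| + #|J|) * mu.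
  move: cQ cQ'; rewrite -/Q -/Q'.
  case: #|I| I0 => // i _; case: #|J| J0 => // j _ /=; rewrite addSn addnS !mulSn mulnDl.
  move: (i * mu) (j * mu) UI cI cU => a b.
  move: #|Q :|: Q'| #|Q :&: Q'| #|Q| #|Q'| => u v c d.
  clear; lia.
have : (#|I| + #|J|) * mu * lam <= 4 * (k * mu).
  have -> : (#|I| + #|J|) * mu * lam = (#|I| * lam + #|J| * lam) * mu by ring.
  have -> : 4 * (k * mu) = (2 * k + 2 * k) * mu by ring.
  by rewrite leq_mul2r leq_add ?orbT.
move=> H1 H2; have kmu : 0 < k * mu by rewrite muln_gt0 k_gt0.
have := leq_trans lam_large (leq_trans (leq_mul H2 (leqnn lam)) H1).
by rewrite leq_pmul2r.
Qed.

(** A common neighbour is shared at [x], shared at [z], or has a unique owner on each side; by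
    [cells_meet] each pair of owners accounts for at most one vertex. *)
Lemma common_nbh_bound x z (I J : {set 'I_n}) :
  x != z -> ~~ e x z -> max_indep x I -> max_indep z J ->
  mu <= #|shared x I :&: nbh z| + #|shared z J :&: nbh x| + #|I| * #|J|.
Proof.
move=> xz exz mI mJ; have [_ _ _ Hmu] := srge.
have -> : #|I| * #|J| = \sum_(y in I) \sum_(w in J) 1.
  by rewrite sum_nat_const sum1_card.
pose B := \sum_(y in I) \sum_(w in J) #|cell x I y :&: cell z J w|.
have HB : B <= \sum_(y in I) \sum_(w in J) 1.
  by apply: leq_sum => y yI; apply: leq_sum => w wJ; apply: cells_meet.
apply: leq_trans (leq_add (leqnn _) HB).
have EB : B = \sum_p \sum_(y in I) \sum_(w in J)
    ((p \in cell x I y) && (p \in cell z J w)).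
  rewrite exchange_big; apply: eq_bigr => y _ /=.
  rewrite exchange_big; apply: eq_bigr => w _ /=.
  rewrite -sum1_card big_mkcond; apply: eq_bigr => p _.
  by rewrite inE; case: (_ && _).
rewrite EB -(Hmu _ _ xz exz) -!sum1_card.
rewrite big_mkcond [X in _ <= X + _ + _]big_mkcond [X in _ <= _ + X + _]big_mkcond.
rewrite -!big_split /=; apply: leq_sum => p _.
have [|//] := boolP (p \in [set u | e x u & e z u]).
rewrite inE => /andP[xp zp].
have oI : 0 < #|owners I p| by apply: max_indep_owned mI _; rewrite inE.
have oJ : 0 < #|owners J p| by apply: max_indep_owned mJ _; rewrite inE.
rewrite !inE xp zp /= !andbT.
have [//|leI] := ltnP 1 #|owners I p|; have [//|leJ] := ltnP 1 #|owners J p|.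
have /cards1P[y Ey] : #|owners I p| == 1 by rewrite eqn_leq leI.
have /cards1P[w Ew] : #|owners J p| == 1 by rewrite eqn_leq leJ.
have yI : y \in I by have := set11 y; rewrite -Ey inE => /andP[].
have wJ : w \in J by have := set11 w; rewrite -Ew inE => /andP[].
rewrite (bigD1 y) //= (bigD1 w) //= !inE xp zp Ey Ew !eqxx.
by rewrite addn_gt0 addn_gt0.
Qed.

Hypothesis two_paths : (n - k.+1) * mu = k * (k - lam.+1).

Lemma lam_le_sqrt : lam * lam <= 16 * n.
Proof.
have n_gt0 : 0 < n.
  by rewrite lt0n; apply/negP => /eqP n0; move: two_paths; rewrite n0 mul0n; nia.
pose x0 := Ordinal n_gt0.
have small := lam_small x0.
have [I mI] := fin_all_exists ex_max_indep.
pose M := n - k.+1; have twoM : M * mu = k * (k - lam.+1) by [].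
pose T x := #|I x|; pose S x := #|shared x (I x)|.
have TT x z : T x * T z * (lam * lam) <= 4 * (k * k).
  have [sI iI _] := mI x; have [sJ iJ _] := mI z.
  have := leq_mul (card_indep x _ sI iI) (card_indep z _ sJ iJ).
  rewrite -/(T x) -/(T z) => H; apply: leq_trans (leq_trans H _).
    by apply: eq_leq; ring.
  by apply: eq_leq; ring.
have SS x : 10 * S x <= k.
  have [sI iI _] := mI x.
  have := card_shared x _ iI; have := card_indep_pairs x _ sI iI.
  rewrite -/(S x); set X := _ * (_ * mu); lia.
(* Sum of [common_nbh_bound] over ordered nonadjacent pairs. The shared terms are extended to all
   pairs, where [sum_card_nbhI] evaluates them. *)
have count : n * (M * mu) <= 2 * (\sum_x S x * k)
    + \sum_x \sum_(z | (z != x) && ~~ e x z) T x * T z.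
  have -> : n * (M * mu) = \sum_(x < n) \sum_(z | (z != x) && ~~ e x z) mu.
    rewrite -[in LHS](card_ord n) -sum_nat_const; apply: eq_bigr => x _.
    by rewrite sum_nat_cond_const /M -(card_nonnbh x).
  have H1 : \sum_x S x * k = \sum_x \sum_z #|shared x (I x) :&: nbh z|.
    by apply: eq_bigr => x _; rewrite sum_card_nbhI.
  have H2 : \sum_x S x * k = \sum_x \sum_z #|shared z (I z) :&: nbh x|.
    by rewrite exchange_big.
  rewrite mul2n -addnn [X in X + _ + _]H1 [X in _ + X + _]H2 -!big_split /=.
  apply: leq_sum => x _.
  rewrite -big_split /= [X in X + _](bigID (fun z => (z != x) && ~~ e x z)) /=.
  rewrite addnAC; apply: leq_trans (leq_addr _ _).
  rewrite -big_split /=; apply: leq_sum => z /andP[zx exz].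
  by apply: common_nbh_bound => //; rewrite eq_sym.
have sumS : 10 * (\sum_x S x * k) <= n * (k * k).
  rewrite big_distrr -[in X in _ <= X](card_ord n) -sum_nat_const /=.
  by apply: leq_sum => x _; rewrite mulnA leq_mul2r SS orbT.
have sumT : (\sum_x \sum_(z | (z != x) && ~~ e x z) T x * T z) * (lam * lam)
    <= n * (M * (4 * (k * k))).
  rewrite big_distrl -[in X in _ <= X](card_ord n) -sum_nat_const /=.
  apply: leq_sum => x _; rewrite big_distrl /=.
  rewrite /M -(card_nonnbh x) -sum_nat_const big_mkcond [X in _ <= X]big_mkcond.
  by apply: leq_sum => z _; rewrite inE; case: ifP => // _; apply: TT.
have H : 10 * (M * mu) * (lam * lam) <= 2 * (k * k) * (lam * lam) + 40 * (M * (k * k)).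
  rewrite -(leq_pmul2l n_gt0).
  have := leq_mul count (leqnn (lam * lam)).
  have := leq_mul sumS (leqnn (lam * lam)); move: sumT.
  move: (\sum_x S x * k) (\sum_x \sum_(z | _) T x * T z) => A B.
  have -> : (2 * A + B) * (lam * lam) = 2 * (A * (lam * lam)) + B * (lam * lam).
    by ring.
  have -> : n * (10 * (M * mu) * (lam * lam)) = 10 * (n * (M * mu) * (lam * lam)).
    by ring.
  have -> : n * (2 * (k * k) * (lam * lam) + 40 * (M * (k * k))) =
      2 * (n * (k * k) * (lam * lam)) + 10 * (n * (M * (4 * (k * k)))) by ring.
  rewrite -(mulnA 10 A).
  move: (A * _) (B * _) (n * _ * _) (n * (k * k) * _) (n * (M * (4 * _))).
  by clear; lia.
(* By [two_paths] and [lam_small], with 36 = 80 - 44. *)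
have MM : 36 * (k * k) <= 80 * (M * mu).
  rewrite twoM mulnBr; have := leq_mul (leqnn k) small.
  by rewrite (mulnCA k) (mulnCA k 44); move: (k * k) (k * _); clear; lia.
have k2 : 0 < k * k by rewrite muln_gt0 k_gt0.
rewrite -(leq_pmul2l k2).
have MML := leq_mul MM (leqnn (lam * lam)).
have kM := leq_mul (leqnn (k * k)) (leq_subr k.+1 n : M <= n).
have E1 : 36 * (k * k) * (lam * lam) = 36 * (k * k * (lam * lam)) by ring.
have E2 : 80 * (M * mu) * (lam * lam) = 8 * (10 * (M * mu) * (lam * lam)) by ring.
have E3 : 2 * (k * k) * (lam * lam) = 2 * (k * k * (lam * lam)) by ring.
have E4 : k * k * (16 * n) = 16 * (k * k * n) by ring.
(* Together: 36 k^2 lam^2 <= 16 k^2 lam^2 + 320 k^2 n, and 320 / 20 = 16. *)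
move: MML kM H; rewrite E1 E2 E3 E4 (mulnC M (k * k)).
move: (10 * _ * _) (k * k * (lam * lam)) (k * k * n) (k * k * M).
by clear; lia.
Qed.

End LocalStructure.

(** * Spectrum and absolute bound *)

Section Rank.
Local Open Scope ring_scope.

(** In a full-rank factorization E = C R, idempotence forces R C = 1, and tr (C R) = tr (R C). *)
Lemma mxtrace_idempotent (F : fieldType) (n : nat) (E : 'M[F]_n) :
  E *m E = E -> \tr E = (\rank E)%:R.
Proof.
move=> EE; have [C' C'C] := row_fullP (col_base_full E).
have [R' RR'] := row_freeP (row_base_free E).
have RC : row_base E *m col_base E = 1%:M.
  have H : col_base E *m row_base E *m (col_base E *m row_base E)
         = col_base E *m row_base E by rewrite mulmx_base.
  move: (col_base E) (row_base E) C'C RR' H => C S C'C SR' H.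
  have := congr1 (fun X => C' *m X *m R') H.
  by rewrite !mulmxA C'C !mul1mx -!mulmxA SR' !mulmx1.
by rewrite -{1}(mulmx_base E) mxtrace_mulC RC mxtrace1.
Qed.

(** Each entry is an inner product of two tensor products of factorization vectors, flattened by
    [mxvec]; so the matrix factors through dimension rank A times rank B. *)
Lemma mxrank_hadamard (F : fieldType) (m n : nat) (A B : 'M[F]_(m, n)) :
  (\rank (map2_mx *%R A B) <= \rank A * \rank B)%nat.
Proof.
pose L := \matrix_i mxvec ((row i (col_base A))^T *m row i (col_base B)).
pose S := \matrix_j mxvec (col j (row_base A) *m (col j (row_base B))^T).
have -> : map2_mx *%R A B = L *m S^T.
  apply/matrixP => i j; rewrite mxE.
  have -> : (L *m S^T) i j = (row i L *m (row j S)^T) 0 0.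
    by rewrite !mxE; apply: eq_bigr => l _; rewrite !mxE.
  rewrite !rowK mxvec_dotmul !mulmxA -mulmxA mxE big_ord1.
  rewrite -trmx_mul.
  have E (D : 'M[F]_(m, n)) :
      (row i (col_base D) *m col j (row_base D)) 0 0 = D i j.
    have := congr1 (fun X : 'M_(m, n) => X i j) (mulmx_base D) => /= <-.
    rewrite mxE [RHS]mxE; apply: eq_bigr => l _.
    by rewrite [row _ _ _ _]mxE [col _ _ _ _]mxE.
  by rewrite E mxE E.
exact: mulmx_max_rank.
Qed.

Lemma mxrank_const (F : fieldType) (m n : nat) (a : F) :
  (\rank (const_mx a : 'M_(m, n)) <= 1)%nat.
Proof.
have -> : const_mx a = (const_mx a : 'cV_m) *m (const_mx 1 : 'rV_n).
  by apply/matrixP => i j; rewrite !mxE big_ord1 !mxE mulr1.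
exact: mulmx_max_rank.
Qed.

End Rank.

(** * Matrix identities of a strongly regular graph *)

Section Spectrum.
Local Open Scope ring_scope.

Variables (n k lam mu : nat) (e : rel 'I_n).
Hypothesis srge : srg k lam mu e.

Local Notation A := (adj_mx e).
Local Notation J := (const_mx 1 : 'M[R]_n).
Local Notation kR := (k%:R : R).
Local Notation lR := (lam%:R : R).
Local Notation mR := (mu%:R : R).
Local Notation nR := (n%:R : R).

Lemma adj_mx_sq : A *m A = (kR - mR)%:M + (lR - mR) *: A + mR *: J.
Proof.
have [[sym irr] reg Hlam Hmu] := srge.
apply/matrixP => i j.
have -> : (A *m A) i j = (#|[set z | e i z & e j z]|)%:R.
  rewrite mxE -sum1_card natr_sum [RHS]big_mkcond; apply: eq_bigr => z _.
  by rewrite !mxE inE (sym z j); case: (e i z); case: (e j z);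
     rewrite ?mulr1 ?mulr0.
rewrite !mxE; have [->|ij] := eqVneq i j.
  have -> : [set z | e j z & e j z] = [set z | e j z].
    by apply/setP => z; rewrite !inE andbb.
  by rewrite reg (negbTE (irr j)) /=; ring.
have [eij|eij] := boolP (e i j); first by rewrite Hlam //=; ring.
by rewrite Hmu //=; ring.
Qed.

Lemma adj_mx_const1 : A *m J = kR *: J.
Proof.
have [_ reg _ _] := srge; apply/matrixP => i j.
rewrite !mxE -(reg i) -sum1_card natr_sum mulr1 [RHS]big_mkcond.
by apply: eq_bigr => z _; rewrite !mxE inE mulr1; case: (e i z).
Qed.

Lemma const_mx1_adj : J *m A = kR *: J.
Proof.
have [[sym _] reg _ _] := srge; apply/matrixP => i j.
rewrite !mxE -(reg j) -sum1_card natr_sum mulr1 [RHS]big_mkcond.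
by apply: eq_bigr => z _; rewrite !mxE inE mul1r (sym z j); case: (e j z).
Qed.

Lemma const_mx1_sq : J *m J = nR *: J.
Proof.
apply/matrixP => i j; rewrite !mxE.
under eq_bigr => z _ do rewrite !mxE mulr1.
by rewrite sumr_const card_ord mulr1.
Qed.

Lemma two_path_count : (0 < n)%nat ->
  kR * kR = kR + lR * kR + mR * (nR - 1 - kR).
Proof.
move=> n0; have : (A *m A) *m J = kR * kR *: J.
  by rewrite -mulmxA adj_mx_const1 -scalemxAr adj_mx_const1 scalerA.
rewrite adj_mx_sq !mulmxDl mul_scalar_mx -!scalemxAl adj_mx_const1 const_mx1_sq.
move/matrixP/(_ (Ordinal n0) (Ordinal n0)); rewrite !mxE => H.
lra.
Qed.

Lemma restricted_eigenvalue_quadratic th : restricted_eigenvalue e th ->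
  th * th = (kR - mR) + (lR - mR) * th.
Proof.
move=> [v [v0 sv Av]].
have Jv : J *m v = 0.
  apply/matrixP => i j; rewrite !mxE -[RHS]sv; apply: eq_bigr => z _.
  by rewrite !mxE mul1r ord1.
have : A *m A *m v = (th * th) *: v.
  by rewrite -mulmxA Av -scalemxAr Av scalerA.
rewrite adj_mx_sq !mulmxDl mul_scalar_mx -!scalemxAl Av Jv scaler0 addr0.
rewrite scalerA -scalerDl => /eqP; rewrite -subr_eq0 -scalerBl scaler_eq0.
by rewrite (negbTE v0) orbF subr_eq0 => /eqP.
Qed.

Lemma mxtrace_adj : \tr A = 0.
Proof.
have [[_ irr] _ _ _] := srge.
by apply: big1 => i _; rewrite mxE (negbTE (irr i)).
Qed.

(** * The projection onto the r-eigenspace and the absolute bound *)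

Section AbsoluteBound.
Variables r s : R.
Hypotheses (n_gt0 : (0 < n)%nat) (rDs : r + s = lR - mR) (rMs : r * s = mR - kR)
  (s_lt_r : s < r).

(** [c] makes [N] annihilate the all-ones vector; [N] is then r - s times the projection onto the
    zero-sum r-eigenvectors, so its rank is the multiplicity of r. *)
Let c : R := (kR - s) / nR.
Let N : 'M[R]_n := A - s%:M - c *: J.

Lemma nR_neq0 : nR != 0.
Proof. by rewrite pnatr_eq0 -lt0n. Qed.

Lemma eigenmatrix_sq : N *m N = (r - s) *: N.
Proof.
have cn : c * nR = kR - s by rewrite /c divfK ?nR_neq0.
(* This is n mu = (k - r) (k - s), a form of [two_path_count]. *)
have cm : mR = c * (kR - r).
  apply: (mulIf nR_neq0); rewrite mulrAC cn.
  have := two_path_count n_gt0.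
  have -> : (kR - s) * (kR - r) = kR * kR - (r + s) * kR + r * s by ring.
  rewrite rDs rMs => H; lra.
have El : lR - mR = r + s by [].
have Ek : kR - mR = - (r * s) by rewrite rMs opprB.
rewrite /N !mulmxBl !mulmxBr adj_mx_sq !mul_scalar_mx !mul_mx_scalar.
rewrite -!scalemxAl -!scalemxAr adj_mx_const1 const_mx1_adj const_mx1_sq El Ek {1}cm.
apply/matrixP => i j; rewrite !mxE !mulr1 cn.
by move: (_%:R) (_%:R) => a b; case: (i == j) => /=; ring.
Qed.

(** Rank equals trace for the idempotent N / (r - s), and A has trace 0. *)
Lemma eigenmatrix_rank : (r - s) * (\rank N)%:R = - (nR * s) - (kR - s).
Proof.
have d0 : r - s != 0 by rewrite subr_eq0 gt_eqF.
have idem : ((r - s)^-1 *: N) *m ((r - s)^-1 *: N) = (r - s)^-1 *: N.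
  by rewrite -scalemxAl -scalemxAr eigenmatrix_sq (scalerA _ (r - s)) mulVf // scale1r.
have := mxtrace_idempotent _ _ _ idem.
rewrite mxrank_scale_nz ?invr_eq0 // mxtraceZ => <-.
rewrite mulrA divff // mul1r /N !linearB /= mxtraceZ mxtrace_scalar mxtrace_adj.
have -> : \tr J = nR.
  rewrite /mxtrace; under eq_bigr => i _ do rewrite mxE.
  by rewrite sumr_const card_ord.
by rewrite /c divfK ?nR_neq0 // sub0r -[s *+ n]mulr_natl.
Qed.

(* Off the diagonal [A - s] takes the values 0 and 1 only, so its Hadamard
   product with [A - s - J] is the scalar matrix [s (s + 1)]. *)
Lemma absolute_bound : s != 0 -> s + 1 != 0 ->
  (n <= (\rank N).+1 * (\rank N).+1)%nat.
Proof.
move=> s0 s1.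
(* [NJ c] is A - s and [NJ (c - 1)] is A - s - J; each differs from [N] by rank at most one. *)
pose NJ (a : R) : 'M[R]_n := N + a *: J.
have rkN (a : R) : (\rank (NJ a) <= (\rank N).+1)%nat.
  apply: leq_trans (mxrank_add _ _) _; rewrite -addn1 leq_add2l.
  have -> : a *: J = const_mx a by apply/matrixP => i j; rewrite !mxE mulr1.
  exact: mxrank_const.
have [[_ irr] _ _ _] := srge.
have Hd : map2_mx *%R (NJ c) (NJ (c - 1)) = (s * (s + 1))%:M.
  apply/matrixP => i j; rewrite !mxE !mulr1; have [<-|ij] /= := eqVneq i j.
    by rewrite (negbTE (irr i)) /=; ring.
  by case: (e i j) => /=; ring.
have rk : \rank (map2_mx *%R (NJ c) (NJ (c - 1))) = n.
  by rewrite Hd -scalemx1 mxrank_scale_nz ?mulf_neq0 // mxrank1.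
rewrite -[X in (X <= _)%nat]rk.
by apply: leq_trans (mxrank_hadamard _ _ _ _ _) _; apply: leq_mul; apply: rkN.
Qed.

End AbsoluteBound.
End Spectrum.

(** * Estimates of lam *)

Section Bounds.
Local Open Scope ring_scope.

Lemma restricted_eigenvalue_n_gt1 (n : nat) (e : rel 'I_n) (th : R) :
  restricted_eigenvalue e th -> (1 < n)%nat.
Proof.
move=> [v [v0 sv _]]; rewrite ltnNge; apply/negP => n1; case/eqP: v0.
apply/matrixP => i j; rewrite [in RHS]mxE ord1 -[RHS]sv (bigD1 i) //= big1 ?addr0 // => l li.
by case/eqP: li; apply: ord_inj; have := ltn_ord i; have := ltn_ord l; lia.
Qed.

Lemma srg_vieta (n k lam mu : nat) (e : rel 'I_n) (r s : R) :
  srg k lam mu e -> restricted_eigenvalue e r -> restricted_eigenvalue e s ->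
  s < r -> r + s = lam%:R - mu%:R /\ r * s = mu%:R - k%:R.
Proof.
move=> G /(restricted_eigenvalue_quadratic _ _ _ _ _ G) qr.
move=> /(restricted_eigenvalue_quadratic _ _ _ _ _ G) qs sr.
have S : r + s = lam%:R - mu%:R.
  apply: (mulfI (_ : r - s != 0)); first by rewrite subr_eq0 gt_eqF.
  have -> : (r - s) * (r + s) = r * r - s * s by ring.
  by rewrite qr qs; ring.
split=> //; have -> : s = lam%:R - mu%:R - r by rewrite -S; ring.
by rewrite mulrBr qr; ring.
Qed.

(* If [M = 0] then [r = K], [s = -1], and both claw terms equal [-1]. *)
Lemma claw_mu_neq0 (N K L M r s : R) : 0 <= L -> 0 <= K ->
  K * K = K + L * K + M * (N - 1 - K) -> r + s = L - M -> r * s = M - K ->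
  s < r -> r <= K ->
  r <= Num.max (2 * (- s - 1) * (M + 1 + s) + s)
               (s * (s + 1) * (M + 1) / 2 - 1) ->
  M != 0.
Proof.
move=> L0 K0 cnt rs1 rs2 sr rK claw; apply/eqP => M0; move: cnt rs1 rs2 claw.
rewrite M0 !mul0r !addr0 subr0 sub0r => cnt rs1 rs2.
have : K * (K - L - 1) = 0 by rewrite !mulrBr cnt; ring.
move/eqP; rewrite mulf_eq0 => /orP[/eqP Kz|/eqP KL].
  by move=> _; lra.
have : (r - K) * (r + 1) = 0.
  have sE : s = L - r by lra.
  have KE : K = L + 1 by lra.
  by move: rs2; rewrite sE KE => rs2; lra.
move/eqP; rewrite mulf_eq0 => /orP[/eqP rE|/eqP r1]; last by move=> _; lra.
have -> : s = -1 by lra.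
by rewrite le_max => /orP[]; lra.
Qed.

Lemma srg_mu_le (N K L M : R) : 0 <= L -> 0 <= K -> 1 < N -> 1 <= M ->
  K * K = K + L * K + M * (N - 1 - K) -> K <= (N - 1) / 2 ->
  [/\ 0 < K, M <= K - L - 1 & N * M <= 3 * (K * K)].
Proof.
move=> L0 K0 N1 M1 cnt KN.
have Kp : 0 < K.
  rewrite lt_neqAle K0 andbT; apply/eqP => Kz.
  have : M * (N - 1) = 0 by move: cnt; rewrite -Kz; lra.
  by move/eqP; rewrite mulf_eq0 => /orP[/eqP|/eqP]; lra.
have ML : M <= K - L - 1.
  rewrite -(ler_pM2l Kp).
  have : 0 <= M * (N - 1 - 2 * K) by apply: mulr_ge0; lra.
  have -> : K * (K - L - 1) = M * (N - 1 - K) by rewrite !mulrBr cnt; ring.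
  rewrite !mulrBr; lra.
split=> //.
(* That is, N M <= 3 M (N - 1 - K), where M (N - 1 - K) = K (K - L - 1) <= K^2. The sign holds
   because [ML] gives K >= 2. *)
have : 0 <= M * (2 * N - 3 - 3 * K) by apply: mulr_ge0; lra.
have : 0 <= L * K by apply: mulr_ge0; lra.
rewrite cnt !mulrBr; lra.
Qed.

Lemma restricted_signs (K L M r s : R) : 0 <= L -> 1 <= M -> M <= K - L - 1 ->
  r + s = L - M -> r * s = M - K -> s < r ->
  [/\ 0 < r, s < -1, L <= M + r & r * - s <= K].
Proof.
move=> L0 M1 ML rs1 rs2 sr.
have r0 : 0 < r by rewrite ltNge; apply/negP => r0; nra.
have s1 : s < -1.
  have : (r + 1) * (s + 1) < 0.
    have -> : (r + 1) * (s + 1) = r * s + (r + s) + 1 by ring.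
    by rewrite rs1 rs2; lra.
  by rewrite pmulr_rlt0; lra.
by split=> //; rewrite ?mulrN ?rs2; lra.
Qed.

Lemma claw_r_le (M r s : R) : 1 <= M -> s < -1 ->
  r <= Num.max (2 * (- s - 1) * (M + 1 + s) + s)
               (s * (s + 1) * (M + 1) / 2 - 1) ->
  r <= s * s * (M + 1).
Proof.
move=> M1 s1 claw; apply: le_trans claw _; rewrite ge_max; apply/andP; split.
  (* [s * s * (M + 1)] exceeds the first claw term by this product, the next one, and -s. *)
  have : 0 <= (s * s + 2 * s + 2) * (M + 1) by apply: mulr_ge0; nra.
  have : 0 <= 2 * (- s - 1) * - s by apply: mulr_ge0; nra.
  lra.
have : 0 <= (s * s - s) * (M + 1) by apply: mulr_ge0; nra.
have : 0 <= s * s * (M + 1) by apply: mulr_ge0; nra.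
lra.
Qed.

Lemma claw_lam_cube (N K L M r s : R) : 0 <= L -> 1 < N -> 1 <= M ->
  M <= K - L - 1 -> N * M <= 3 * (K * K) -> 0 < r -> s < -1 -> L <= M + r ->
  r * - s <= K -> r <= s * s * (M + 1) ->
  L ^+ 3 * N <= 36 * K ^+ 4.
Proof.
move=> L0 N1 M1 ML NM r0 s1 LL rs rle.
have r3 : r ^+ 3 <= K ^+ 2 * (M + 1).
  have -> : r ^+ 3 = r ^+ 2 * r by rewrite -exprSr.
  apply: (@le_trans _ _ (r ^+ 2 * (s * s * (M + 1)))).
    by rewrite ler_wpM2l // exprn_ge0 // ltW.
  have -> : r ^+ 2 * (s * s * (M + 1)) = (r * - s) ^+ 2 * (M + 1) by ring.
  rewrite ler_wpM2r //; first by lra.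
  by rewrite lerXn2r // nnegrE; [nra|lra].
have L3 : L ^+ 3 <= 4 * (M ^+ 3 + r ^+ 3).
  apply: (@le_trans _ _ ((M + r) ^+ 3)).
    by rewrite lerXn2r // nnegrE; lra.
  (* Equals 4 (M^3 + r^3) - (M + r)^3. *)
  have : 0 <= 3 * (M + r) * (M - r) ^+ 2.
    by rewrite mulr_ge0 ?sqr_ge0 //; lra.
  lra.
have M3 : M ^+ 3 * N <= 3 * K ^+ 4.
  have -> : M ^+ 3 * N = (M * M) * (N * M) by ring.
  have -> : 3 * K ^+ 4 = (K * K) * (3 * (K * K)) by ring.
  by rewrite ler_pM //; nra.
have R3 : r ^+ 3 * N <= 6 * K ^+ 4.
  apply: (@le_trans _ _ (K ^+ 2 * (M + 1) * N)).
    by rewrite ler_wpM2r //; lra.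
  have -> : K ^+ 2 * (M + 1) * N = K ^+ 2 * ((M + 1) * N) by ring.
  have -> : 6 * K ^+ 4 = K ^+ 2 * (6 * (K * K)) by ring.
  by rewrite ler_wpM2l ?sqr_ge0 //; nra.
(* The constant is 36 = 4 (3 + 6), from [M3] and [R3]. *)
apply: (@le_trans _ _ (4 * (M ^+ 3 + r ^+ 3) * N)).
  by rewrite ler_wpM2r //; lra.
rewrite -mulrA mulrDl; lra.
Qed.

(** The alternatives are L <= 2 M and L <= 2 r. In the second, f r^2 <= N K is squared and compared
    with N <= (f + 1)^2, using f + 1 <= 2 f. *)
Lemma absolute_lam_quartic (N K L M r s f : R) : 0 <= L -> 1 < N -> 1 <= M ->
  M <= K - L - 1 -> N * M <= 3 * (K * K) -> 0 < r -> s < -1 -> L <= M + r ->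
  r * - s <= K -> 1 <= f -> N <= (f + 1) ^+ 2 ->
  (r - s) * f = - (N * s) - (K - s) ->
  L * N <= 6 * K ^+ 2 \/ L ^+ 4 <= 64 * (K ^+ 2 * N).
Proof.
move=> L0 N1 M1 ML NM r0 s1 LL rs f1 Nf tr.
have [rM|Mr] := leP r M.
  left; rewrite expr2; have : L * N <= 2 * M * N by rewrite ler_wpM2r //; lra.
  lra.
right.
have rf : r * f <= N * - s.
  have : 0 <= - s * f by apply: mulr_ge0; lra.
  lra.
have r2f : r ^+ 2 * f <= N * K.
  have -> : r ^+ 2 * f = r * (r * f) by ring.
  apply: (@le_trans _ _ (r * (N * - s))); first by rewrite ler_wpM2l // ltW.
  have -> : r * (N * - s) = N * (r * - s) by ring.
  by rewrite ler_wpM2l //; lra.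
have r2f1 : r ^+ 2 * (f + 1) <= 2 * (N * K).
  have : r ^+ 2 * (f + 1) <= r ^+ 2 * (2 * f) by rewrite ler_wpM2l ?sqr_ge0 //; lra.
  lra.
have r4 : r ^+ 4 <= 4 * (K ^+ 2 * N).
  have N0 : 0 < N by lra.
  rewrite -(ler_pM2r N0).
  apply: (@le_trans _ _ (r ^+ 4 * (f + 1) ^+ 2)).
    by rewrite ler_wpM2l // exprn_ge0 // ltW.
  have -> : r ^+ 4 * (f + 1) ^+ 2 = (r ^+ 2 * (f + 1)) ^+ 2 by ring.
  have -> : 4 * (K ^+ 2 * N) * N = (2 * (N * K)) ^+ 2 by ring.
  by rewrite lerXn2r // nnegrE; [apply: mulr_ge0; [exact: sqr_ge0|lra]|nra].
apply: (@le_trans _ _ ((2 * r) ^+ 4)).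
  by rewrite lerXn2r ?nnegrE //; lra.
by rewrite exprMn; lra.
Qed.


Lemma exprn_powR (a x y : R) (d : nat) : 0 <= a -> x * d%:R = y ->
  powR a x ^+ d = powR a y.
Proof. by move=> a0 <-; rewrite -powR_mulrn ?powR_ge0 // -powRrM. Qed.

(** Raising to the powers 3, 4 and 2 clears the fractional exponents. The factor 8 suffices: 8^3 >=
    36, 8 >= 6, 8^4 >= 64, 8^2 >= 60 and 8^2 >= 16. *)
Lemma div_le_h_fun (n k : nat) (L : R) : (0 < n)%nat -> 0 <= L ->
  L ^+ 3 * n%:R <= 36 * k%:R ^+ 4 ->
  L * n%:R <= 6 * k%:R ^+ 2 \/ L ^+ 4 <= 64 * (k%:R ^+ 2 * n%:R) ->
  L ^+ 2 * n%:R <= 60 * k%:R ^+ 3 \/ L ^+ 2 <= 16 * n%:R ->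
  L / n%:R <= 8 * h_fun n k.
Proof.
move=> n0 L0 h1 h2 h3; rewrite /h_fun /=.
have N0 : 0 < n%:R :> R by rewrite ltr0n.
have K0 : 0 <= k%:R :> R by [].
move: h1 h2 h3; set N : R := n%:R in N0 *; set K : R := k%:R in K0 *.
move=> h1 h2 h3; have N'0 : 0 < N^-1 by rewrite invr_gt0.
have NN : N * N^-1 = 1 by rewrite divff // gt_eqF.
have LN0 : 0 <= L / N by rewrite divr_ge0 // ltW.
have KN0 : 0 <= K / N by rewrite divr_ge0 // ltW.
have root (d : nat) (a b : R) : (0 < d)%nat -> 0 <= a -> 0 <= b ->
    a ^+ d <= b ^+ d -> a <= b.
  by move=> d0 a0 b0; rewrite ler_pXn2r // nnegrE.
have B1 : L / N <= 8 * powR (K / N) (4 / 3).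
  apply: (root 3%nat) => //; first by rewrite mulr_ge0 ?powR_ge0.
  rewrite !exprMn (exprn_powR _ _ 4%:R) // ?powR_mulrn //; last by lra.
  rewrite exprMn.
  have := ler_wpM2r (ltW (exprn_gt0 4 N'0)) h1.
  have -> : L ^+ 3 * N * N^-1 ^+ 4 = L ^+ 3 * N^-1 ^+ 3 * (N * N^-1) by ring.
  rewrite NN mulr1; have : 0 <= K ^+ 4 * N^-1 ^+ 4.
    by rewrite mulr_ge0 ?exprn_ge0 // ltW.
  by move: (L ^+ 3 * _) => u; lra.
have B2 : L / N <= 8 * Num.max (powR K (1 / 2) / powR N (3 / 4)) (powR (K / N) 2).
  case: h2 => h.
    apply: (@le_trans _ _ (8 * powR (K / N) 2)); last first.
      by rewrite ler_wpM2l // le_max lexx orbT.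
    rewrite powR_mulrn // exprMn.
    have := ler_wpM2r (ltW (exprn_gt0 2 N'0)) h.
    have -> : L * N * N^-1 ^+ 2 = L * N^-1 * (N * N^-1) by ring.
    rewrite NN mulr1; have : 0 <= K ^+ 2 * N^-1 ^+ 2.
      by rewrite mulr_ge0 ?exprn_ge0 // ltW.
    by move: (L * _) => u; lra.
  apply: (@le_trans _ _ (8 * (powR K (1 / 2) / powR N (3 / 4)))); last first.
    by rewrite ler_wpM2l // le_max lexx.
  apply: (root 4%nat) => //; first by rewrite mulr_ge0 ?divr_ge0 ?powR_ge0.
  have EN : (powR N (3 / 4))^-1 ^+ 4 = N^-1 ^+ 3.
    rewrite !exprVn (exprn_powR N _ 3%:R) ?powR_mulrn ?(ltW N0) //; lra.
  rewrite !exprMn EN (exprn_powR K _ 2%:R) ?powR_mulrn //; last by lra.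
  have := ler_wpM2r (ltW (exprn_gt0 4 N'0)) h.
  have -> : 64 * (K ^+ 2 * N) * N^-1 ^+ 4
    = 64 * (K ^+ 2 * N^-1 ^+ 3) * (N * N^-1) by ring.
  rewrite NN mulr1; have : 0 <= K ^+ 2 * N^-1 ^+ 3.
    by rewrite mulr_ge0 ?exprn_ge0 // ltW.
  by move: (L ^+ 4 * _) => u; lra.
have B3 : L / N <= 8 * Num.max (powR (K / N) (3 / 2)) (powR (1 / N) (1 / 2)).
  case: h3 => h.
    apply: (@le_trans _ _ (8 * powR (K / N) (3 / 2))); last first.
      by rewrite ler_wpM2l // le_max lexx.
    apply: (root 2%nat) => //; first by rewrite mulr_ge0 ?powR_ge0.
    rewrite !exprMn (exprn_powR _ _ 3%:R) // ?powR_mulrn //; last by lra.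
    rewrite exprMn.
    have := ler_wpM2r (ltW (exprn_gt0 3 N'0)) h.
    have -> : L ^+ 2 * N * N^-1 ^+ 3 = L ^+ 2 * N^-1 ^+ 2 * (N * N^-1) by ring.
    rewrite NN mulr1; have : 0 <= K ^+ 3 * N^-1 ^+ 3.
      by rewrite mulr_ge0 ?exprn_ge0 // ltW.
    by move: (L ^+ 2 * _) => u; lra.
  apply: (@le_trans _ _ (8 * powR (1 / N) (1 / 2))); last first.
    by rewrite ler_wpM2l // le_max lexx orbT.
  have N10 : 0 <= 1 / N by rewrite mul1r ltW.
  apply: (root 2%nat) => //; first by rewrite mulr_ge0 ?powR_ge0.
  rewrite !exprMn (exprn_powR _ _ 1%:R) // ?powR_mulrn //; last by lra.
  rewrite mul1r expr1.
  have := ler_wpM2r (ltW (exprn_gt0 2 N'0)) h.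
  have -> : 16 * N * N^-1 ^+ 2 = 16 * N^-1 * (N * N^-1) by ring.
  by rewrite NN mulr1; move: (L ^+ 2 * _) => u; lra.
by rewrite !minElt; case: ifP => _ //; case: ifP.
Qed.

End Bounds.

(** * Assembly of the three bounds *)

Local Open Scope ring_scope.

Theorem theorem20 :
  exists C : R, 0 < C /\
  forall (n k lam mu : nat) (e : rel 'I_n) (r s : R),
    srg k lam mu e ->
    (k%:R <= (n%:R - 1) / 2 :> R) ->
    restricted_eigenvalue e r -> restricted_eigenvalue e s ->
    s < r -> r <= k%:R ->
    r <= Num.max (2 * (- s - 1) * (mu%:R + 1 + s) + s)
                 (s * (s + 1) * (mu%:R + 1) / 2 - 1) ->
    lam%:R / n%:R <= C * h_fun n k.
Proof.
exists 8; split=> [//|n k lam mu e r s G kn er es sr rk claw].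
have n1 := restricted_eigenvalue_n_gt1 _ _ _ er.
have n0 : (0 < n)%nat by apply: ltnW.
have [rs1 rs2] := srg_vieta _ _ _ _ _ _ _ G er es sr.
have cnt := two_path_count _ _ _ _ _ G n0.
have L0 : 0 <= lam%:R :> R by [].
have K0 : 0 <= k%:R :> R by [].
have N1 : 1 < n%:R :> R by rewrite ltr1n.
have M1 : 1 <= mu%:R :> R.
  have := claw_mu_neq0 _ _ _ _ _ _ L0 K0 cnt rs1 rs2 sr rk claw.
  by rewrite pnatr_eq0 ler1n lt0n.
have [Kp ML NM] := srg_mu_le _ _ _ _ L0 K0 N1 M1 cnt kn.
have [r0 s1 LL rsK] := restricted_signs _ _ _ _ _ L0 M1 ML rs1 rs2 sr.
have rle := claw_r_le _ _ _ M1 s1 claw.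
apply: div_le_h_fun => //.
- exact: claw_lam_cube L0 N1 M1 ML NM r0 s1 LL rsK rle.
- have tr := eigenmatrix_rank _ _ _ _ _ G _ _ n0 rs1 rs2 sr.
  have s_neq0 : s != 0 by rewrite lt_eqF //; lra.
  have s1_neq0 : s + 1 != 0 by rewrite lt_eqF //; lra.
  have := absolute_bound _ _ _ _ _ G _ s_neq0 s1_neq0.
  move: tr; set f := \rank _ => tr nf.
  have fN : n%:R <= (f%:R + 1) ^+ 2 :> R by rewrite natr1 -natrX ler_nat expnS expn1.
  (* f = 0 would turn the absolute bound into n <= 1. *)
  have f1 : 1 <= f%:R :> R.
    rewrite ler1n lt0n; apply/negP => /eqP f0; move: nf; rewrite f0.
    by rewrite leqNgt n1.
  exact: absolute_lam_quartic L0 N1 M1 ML NM r0 s1 LL rsK f1 fN tr.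
have lk : (lam.+1 < k)%nat by rewrite -(ltr_nat R) -natr1; lra.
have k_lt_n : (k < n)%nat by rewrite -(ltr_nat R); lra.
have k0 : (0 < k)%nat by rewrite -(ltr_nat R).
have m0 : (0 < mu)%nat by rewrite -(ltr_nat R); lra.
have two_paths : ((n - k.+1) * mu = k * (k - lam.+1))%nat.
  apply/eqP; rewrite -(eqr_nat R) !natrM !natrB //; last by apply: ltnW.
  by rewrite -!natr1; apply/eqP; lra.
have [big|small] := leqP (20 * (k * mu))%nat (lam * lam)%nat.
  right; have := lam_le_sqrt _ _ _ _ _ G k0 m0 big lk two_paths.
  by rewrite -(ler_nat R) !natrM expr2.
(* For small lam, lam^2 n <= 20 k mu n <= 60 k^3, as mu n <= 3 k^2. *)
left; have : (lam * lam)%:R <= (20 * (k * mu))%:R :> R by rewrite ler_nat ltnW.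
rewrite !natrM => LM.
apply: (@le_trans _ _ (20 * (k%:R * mu%:R) * n%:R)); first by rewrite expr2 ler_wpM2r.
have := ler_wpM2l K0 NM; lra.
Qed.
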